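(* Let $Y\subsetneq W$ be multiprojective spaces, with $Y$ a multiprojective subspace of $W$, and let $\nu:W\to\mathbb{P}^N$ be the Segre embedding of $W$. Let $q\in\langle\nu(Y)\rangle$. Then there is a finite set $B\subset W$ such that $B\nsubseteq Y$ and $\nu(B)\in\mathcal{S}(\nu(W),q,r_{\nu(Y)}(q)+1)$.
   Context: Everything is over an algebraically closed field $\mathbb{K}$. A multiprojective space is a product $W=\mathbb{P}^{n_1}\times\cdots\times\mathbb{P}^{n_k}$ with $k\ge 1$ and $n_i>0$ for all $i$. Its Segre embedding is $\nu:W\to\mathbb{P}^N$, $N=(n_1+1)\cdots(n_k+1)-1$, $([v_1],\dots,[v_k])\mapsto[v_1\otimes\cdots\otimes v_k]$. A multiprojective subspace $Y\subseteq W$ is a product $Y=L_1\times\cdots\times L_k$ with each $L_i\subseteq\mathbb{P}^{n_i}$ a non-empty linear subspace. Some $L_i$ may be single points. Here $Y$, being a multiprojective space, is assumed to have positive dimension. $\langle\ \rangle$ denotes linear span in projective space. A finite set $A\subset\mathbb{P}^N$ irredundantly spans $q\in\mathbb{P}^N$ if $q\in\langle A\rangle$ and $q\notin\langle A'\rangle$ for every proper subset $A'\subsetneq A$. For a subvariety $X\subseteq\mathbb{P}^N$ and $q\in\langle X\rangle$, the $X$-rank $r_X(q)$ is the minimal cardinality of a finite set $A\subset X$ with $q\in\langle A\rangle$. For a positive integer $t$, $\mathcal{S}(X,q,t)$ is the set of all $A\subset X$ such that $\#A=t$ and $A$ irredundantly spans $q$. *)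

(* Defs.v *)
From HB Require Import structures.
From mathcomp Require Import all_boot all_order all_algebra.
From mathcomp Require Import finmap.
From mathcomp Require Import boolp classical_sets.

Set Implicit Arguments.
Unset Strict Implicit.
Unset Printing Implicit Defensive.

Import GRing.Theory.
Local Open Scope classical_set_scope.
Local Open Scope ring_scope.

(* P(V): the set of lines through 0 in V.  Subspaces of V are canonical
   objects, so Leibniz equality is equality of points. *)
Record proj (K : fieldType) (V : vectType K) := Proj {
  line :> {vspace V};
  dim_line : \dim line == 1%N
}.

HB.instance Definition _ (K : fieldType) (V : vectType K) :=
  [isSub for @line K V].
HB.instance Definition _ (K : fieldType) (V : vectType K) :=
  [Choice of proj V by <:].

Lemma dim_vline_neq0 (K : fieldType) (V : vectType K) (v : V) :
  v != 0 -> \dim <[v]>%VS == 1%N.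
Proof. by rewrite dim_vline => ->. Qed.

Definition point (K : fieldType) (V : vectType K) (v : V) (v0 : v != 0) :
    proj V :=
  Proj (dim_vline_neq0 v0).

Notation "''P[' K ]_ n" := (proj 'rV[K]_n.+1)
  (at level 8, n at level 2, format "''P[' K ]_ n") : type_scope.

(* Linear subspaces of P(V) are encoded by the subspaces U of V; a point p lies
   on U when (p <= U)%VS, and U = 0 is the empty linear subspace. *)
Definition pspan (K : fieldType) (V : vectType K) (S : set (proj V)) :
    set (proj V) :=
  [set q | forall U : {vspace V},
     (forall p, S p -> (p <= U)%VS) -> (q <= U)%VS].

Definition irredundantly_spans (K : fieldType) (V : vectType K)
    (A : {fset proj V}) (q : proj V) : Prop :=
  pspan [set` A] q /\
  forall A' : {fset proj V}, (A' `<` A)%fset -> ~ pspan [set` A'] q.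

Definition spanned_by_card (K : fieldType) (V : vectType K)
    (X : set (proj V)) (q : proj V) (r : nat) : Prop :=
  exists A : {fset proj V},
    [/\ [set` A] `<=` X, #|` A|%fset = r & pspan [set` A] q].

(* The value 0 is only taken when no finite subset of X spans q, which does not
   happen for q in pspan X. *)
Definition Xrank (K : fieldType) (V : vectType K)
    (X : set (proj V)) (q : proj V) : nat :=
  match pselect (exists r, `[< spanned_by_card X q r >]) with
  | left h => ex_minn h
  | right _ => 0%N
  end.

Lemma XrankP (K : fieldType) (V : vectType K)
    (X : set (proj V)) (q : proj V) (A : {fset proj V}) :
  [set` A] `<=` X -> pspan [set` A] q ->
  spanned_by_card X q (Xrank X q) /\
  forall r, spanned_by_card X q r -> (Xrank X q <= r)%N.
Proof.
move=> AX Aq; rewrite /Xrank; case: pselect => [h|[]]; last first.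
  by exists #|` A|%fset; apply/asboolP; exists A.
case: ex_minnP => r /asboolP hr hmin; split=> // s hs.
by apply/hmin/asboolP.
Qed.

Definition solutions (K : fieldType) (V : vectType K)
    (X : set (proj V)) (q : proj V) (t : nat) : set {fset proj V} :=
  [set A | [/\ [set` A] `<=` X, #|` A|%fset = t & irredundantly_spans A q]].

Section Multiprojective.
Variables (K : fieldType) (k : nat) (n : 'I_k -> nat).

Definition multiproj := {dffun forall i : 'I_k, 'P[K]_(n i)}.

Definition multiindex := {dffun forall i : 'I_k, 'I_(n i).+1}.

(* K^(n_1+1) (x) ... (x) K^(n_k+1), of dimension N+1, given by coordinates in
   the basis of tensor products of standard basis vectors. *)
Definition tensor_space := {ffun multiindex -> K^o}.

Lemma dim_tensor_space :
  \dim {: tensor_space} = (\prod_(i < k) (n i).+1)%N.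
Proof.
rewrite dimvf /= /dim /= muln1 card_dep_ffun foldrE big_map big_enum /=.
by apply: eq_bigr => i _; rewrite card_ord.
Qed.

Definition tensor (v : forall i : 'I_k, 'rV[K]_(n i).+1) : tensor_space :=
  [ffun J : multiindex => \prod_(i < k) v i 0 (J i)].

Lemma tensor_neq0 (v : forall i : 'I_k, 'rV[K]_(n i).+1) :
  (forall i, v i != 0) -> tensor v != 0.
Proof.
move=> v0.
have h i : {j | v i 0 j != 0}.
  apply: sigW; have /rV0Pn[j vj] := v0 i.
  by exists j.
apply/eqP => /ffunP/(_ [ffun i => sval (h i)]).
rewrite !ffunE => /eqP; rewrite prodf_seq_eq0 => /hasP[i _] /=.
by rewrite ffunE (negPf (svalP (h i))).
Qed.

Lemma vpick_proj_neq0 (V : vectType K) (p : proj V) : vpick p != 0.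
Proof. by rewrite vpick0 -dimv_eq0 (eqP (dim_line p)). Qed.

Definition segre (x : multiproj) : proj tensor_space :=
  point (tensor_neq0 (fun i => vpick_proj_neq0 (x i))).

Lemma line_vpick (V : vectType K) (p : proj V) : (<[vpick p]> = p)%VS.
Proof.
apply/eqP; rewrite eqEdim -memvE memv_pick /= dim_vline vpick_proj_neq0.
by rewrite (eqP (dim_line p)).
Qed.

(* segre does not depend on the chosen representatives. *)
Lemma segreE (v : forall i : 'I_k, 'rV[K]_(n i).+1) (v0 : forall i, v i != 0) :
  segre [ffun i => point (v0 i)] = point (tensor_neq0 v0).
Proof.
apply: val_inj; rewrite /=.
set w := fun i => vpick _.
have hw i : {c : K | w i == c *: v i}.
  apply: sigW; have := memv_pick <[v i]>%VS; rewrite /w ffunE.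
  by case/vlineP => c ->; exists c.
have cw0 i : sval (hw i) != 0.
  apply/eqP => c0; have := svalP (hw i); rewrite /= c0 scale0r.
  exact/negP/vpick_proj_neq0.
have -> : tensor w = (\prod_i sval (hw i)) *: tensor v.
  apply/ffunP => J; rewrite !ffunE /= -[_ *: _]/(_ * _) -big_split /=.
  by apply: eq_bigr => i _; rewrite {1}(eqP (svalP (hw i))) mxE.
have c0 : \prod_i sval (hw i) != 0 by apply/prodf_neq0 => i _.
apply/eqP; rewrite eqEdim -memvE memvZ ?memv_line //= !dim_vline.
by rewrite scaler_eq0 (negPf c0) tensor_neq0.
Qed.

(* The product of the linear subspaces of the P^{n_i} given by the L i. *)
Definition multisub (L : forall i : 'I_k, {vspace 'rV[K]_(n i).+1}) :
    set multiproj :=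
  [set x : multiproj | forall i, (x i <= L i)%VS].

Definition multisub_dim (L : forall i : 'I_k, {vspace 'rV[K]_(n i).+1}) : nat :=
  \sum_(i < k) (\dim (L i)).-1.

End Multiprojective.

(* Main.v *)
(** Let [A] be a set of [r] points of the Segre image of [Y] that spans [q],
    with [r] minimal.  Some [L i0] is a proper subspace; choose a vector [u]
    outside it and split one point [a] of [A] along the factor [i0], writing
    [a_i0 = u + (a_i0 - u)].  Replacing [a] by the two resulting points [b] and
    [b'] keeps [q] in the span.  Let [U] be the space of tensors whose slice
    along the factor [i0], at a multi-index where [a] has nonzero coordinates,
    lies in [L i0].  It contains the Segre image of [Y] but neither [b] nor
    [b'], so the line through [b] and [b'] meets it only in [a].  Hence
    intersecting with [U] turns a redundancy of the new set into a redundancy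
    of [A], which is impossible. *)
From HB Require Import structures.
Require Import Defs.
From mathcomp Require Import all_boot all_order all_algebra.
From mathcomp Require Import finmap.
From mathcomp Require Import boolp classical_sets.

Import GRing.Theory.

Local Open Scope classical_set_scope.
Local Open Scope ring_scope.

Set Implicit Arguments.
Unset Strict Implicit.
Unset Printing Implicit Defensive.

Section ProjectiveSpan.
Context {K : fieldType} {V : vectType K}.
Implicit Types (p q : proj V) (A : {fset proj V}) (U : {vspace V}).

Definition fset_span A : {vspace V} := (\sum_(p <- A) line p)%VS.

Lemma fset_span_sub A U :
  (forall p, p \in A -> (p <= U)%VS) -> (fset_span A <= U)%VS.
Proof.
rewrite /fset_span big_seq => AU.
by elim/big_ind: _ => [|W1 W2 h1 h2|p /AU//]; rewrite ?sub0v// subv_add h1.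
Qed.

Lemma sub_fset_span A p : p \in A -> (p <= fset_span A)%VS.
Proof. by move=> pA; rewrite /fset_span (big_fsetD1 p)//= addvSl. Qed.

Lemma fset_spanS A A' : (A `<=` A')%fset -> (fset_span A <= fset_span A')%VS.
Proof.
by move=> /fsubsetP AA'; apply: fset_span_sub => p /AA'; exact: sub_fset_span.
Qed.

Lemma fset_spanU1 p A :
  fset_span (p |` A)%fset = (p + fset_span A)%VS.
Proof.
apply/eqP; rewrite eqEsubv; apply/andP; split.
  apply: fset_span_sub => x /fset1UP[->|xA]; first exact: addvSl.
  exact: subv_trans (sub_fset_span _) (addvSr _ _).
rewrite subv_add sub_fset_span ?fset1U1//=.
exact/fset_spanS/fsubsetUr.
Qed.

Lemma pspan_fset A q : pspan [set` A] q <-> (q <= fset_span A)%VS.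
Proof.
split=> [|qA U AU]; first by apply => p; exact: sub_fset_span.
exact/(subv_trans qA)/fset_span_sub.
Qed.

(** A finite subset of [X] whose span has maximal dimension already spans every point of [X]. This
    makes [Xrank] an attained minimum instead of the default value 0. *)
Lemma pspan_finite (X : set (proj V)) q : pspan X q ->
  exists A, [set` A] `<=` X /\ pspan [set` A] q.
Proof.
pose P d := `[< exists A, [set` A] `<=` X /\ \dim (fset_span A) = d >].
have exP : exists d, P d.
  by exists (\dim (fset_span fset0)); apply/asboolP; exists fset0.
have leP d : P d -> (d <= \dim {: V})%N.
  by move=> /asboolP[A [_ <-]]; apply/dimvS/subvf.
case: (ex_maxnP exP leP) => d /asboolP[A [AX <-]] dmax Xq.
exists A; split=> //; apply/pspan_fset/Xq => p Xp.
have : (\dim (fset_span (p |` A)%fset) <= \dim (fset_span A))%N.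
  apply/dmax/asboolP; exists (p |` A)%fset; split=> // x /fset1UP[->//|].
  exact: AX.
rewrite fset_spanU1 => h.
have /eqP -> : fset_span A == (p + fset_span A)%VS by rewrite eqEdim addvSr.
exact: addvSl.
Qed.

Lemma proj_cap0 p U : ~~ (p <= U)%VS -> (p :&: U = 0)%VS.
Proof.
move=> pU; apply/eqP; rewrite -dimv_eq0.
have : (\dim (p :&: U) <= 1)%N by rewrite -(eqP (dim_line p)) dimvS ?capvSl.
rewrite leq_eqVlt ltnS leqn0 => /orP[|//] /eqP d1.
case/negP: pU; apply/capv_idPl/eqP.
by rewrite eqEdim capvSl d1 (eqP (dim_line p)).
Qed.

(** The sum [b + b'] has dimension at most 2 and is not inside [U], so its intersection with [U] has
    dimension at most 1 and is exhausted by [a]. *)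
Lemma cap_secant (a b b' : proj V) U : (a <= U)%VS -> ~~ (b <= U)%VS ->
  (a <= b + b')%VS -> ((b + b') :&: U = a)%VS.
Proof.
move=> aU bU abb'; apply/esym/eqP; rewrite eqEdim subv_cap abb' aU /=.
rewrite (eqP (dim_line a)) -ltnS.
have d2 : (\dim (b + b') <= 2)%N.
  by rewrite (leq_trans (dimv_add_leqif _ _).1)// !(eqP (dim_line _)).
apply: leq_trans d2; rewrite ltn_neqAle dimvS ?capvSl// andbT.
apply: contra bU => /eqP d.
have /eqP h : ((b + b') :&: U == b + b')%VS by rewrite eqEdim capvSl d/=.
by apply: (subv_trans (addvSl b b')); rewrite -h capvSr.
Qed.

Lemma irredundantly_spans_split A q (a b b' : proj V) U :
  irredundantly_spans A q -> (forall p, p \in A -> (p <= U)%VS) -> a \in A ->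
  ~~ (b <= U)%VS -> ~~ (b' <= U)%VS -> (a <= b + b')%VS ->
  irredundantly_spans (b |` (b' |` A `\ a))%fset q /\
  #|` (b |` (b' |` A `\ a))|%fset = #|` A|.+1.
Proof.
move=> [/pspan_fset qA Amin] AU aA bU b'U abb'.
have aU := AU _ aA.
have A0U : (fset_span (A `\ a)%fset <= U)%VS.
  by apply: fset_span_sub => p /fsetD1P[_ /AU].
have qU : (q <= U)%VS by apply: subv_trans qA _; exact: fset_span_sub.
have notin (c : proj V) : ~~ (c <= U)%VS -> c \notin (A `\ a)%fset.
  by apply: contra => /fsetD1P[_ /AU].
have nsub x : x \in A -> ~~ (q <= fset_span (A `\ x)%fset)%VS.
  move=> xA; apply/negP => /pspan_fset.
  by apply: Amin; exact: fproperD1.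
(* Modular law: [(W + c) :&: U = W + (c :&: U) = W], and [q] lies in [U]. *)
have capb (c : proj V) W : (W <= U)%VS -> ~~ (c <= U)%VS ->
    (q <= c + W)%VS -> (q <= W)%VS.
  move=> WU cU qcW; have : (q <= (W + c) :&: U)%VS by rewrite subv_cap addvC qcW.
  by rewrite -vspace_modl// proj_cap0// addv0.
have bb' : b != b'.
  apply: contra bU => /eqP bb'; move: abb'; rewrite -bb' addvv => ab.
  suff /eqP <- : line a == line b by [].
  by rewrite eqEdim ab !(eqP (dim_line _)).
split; last first.
  rewrite !cardfsU1 in_fset1U negb_or bb' !notin //= !add1n.
  by rewrite (cardfsD1 a A) aA.
split.
  apply/pspan_fset; rewrite !fset_spanU1 addvA.
  apply: subv_trans qA _; rewrite -{1}(fsetD1K aA) fset_spanU1.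
  exact: addvS.
move=> B'; rewrite fproperE => /andP[/fsubsetP B'B /fsubsetPn[x xB xB']].
move=> /pspan_fset qB'.
(* Enlarging the proper subset, one may assume that exactly one point [x] is omitted. *)
have {}qB' : (q <= fset_span ((b |` (b' |` A `\ a)) `\ x)%fset)%VS.
  apply: subv_trans qB' _; apply: fset_spanS; apply/fsubsetP => y yB'.
  rewrite in_fsetD1 B'B// andbT; apply: contraNneq xB' => <-.
  exact: yB'.
move: xB; rewrite 2!in_fset1U => /or3P[/eqP xb|/eqP xb'|xA0].
- have : (q <= b' + fset_span (A `\ a)%fset)%VS.
    rewrite -fset_spanU1; apply: subv_trans qB' _; apply: fset_spanS.
    by rewrite xb fsubDset.
  by move/(capb _ _ A0U b'U); exact/negP/nsub.
- have : (q <= b + fset_span (A `\ a)%fset)%VS.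
    rewrite -fset_spanU1; apply: subv_trans qB' _; apply: fset_spanS.
    apply/fsubsetP => y /fsetD1P[yx /fset1UP[->|/fset1UP[yb'|]]].
    + exact: fset1U1.
    + by rewrite yb' xb' eqxx in yx.
    + exact: fset1Ur.
  by move/(capb _ _ A0U bU); exact/negP/nsub.
(* Both [b] and [b'] remain here: cutting with [U] replaces [b + b'] by [a], so [A] without [x]
   would span [q]. *)
have /fsetD1P[xa xA] := xA0.
pose W := fset_span (A `\ a `\ x)%fset.
have WU : (W <= U)%VS by apply: subv_trans A0U; apply/fset_spanS/fsubD1set.
have qW : (q <= (b + b') + W)%VS.
  rewrite -addvA -!fset_spanU1; apply: subv_trans qB' _; apply: fset_spanS.
  apply/fsubsetP => y /fsetD1P[yx /fset1UP[->|/fset1UP[->|/fsetD1P[ya yA]]]].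
  - exact: fset1U1.
  - by apply: fset1Ur; exact: fset1U1.
  - by do 2!apply: fset1Ur; do 2?[apply/fsetD1P; split].
have : (q <= (W + (b + b')) :&: U)%VS by rewrite subv_cap addvC qW.
rewrite -vspace_modl// (cap_secant aU bU abb') => qWa.
case/negP: (nsub _ xA); apply: subv_trans qWa _.
rewrite addvC -fset_spanU1; apply: fset_spanS; apply/fsubsetP => y.
move=> /fset1UP[->|/fsetD1P[yx /fsetD1P[ya yA]]]; apply/fsetD1P; split=> //.
by rewrite eq_sym.
Qed.

End ProjectiveSpan.

Lemma fset_preimage (S T : choiceType) (f : S -> T) (A : {fset T}) :
  [set` A] `<=` range f -> exists B : {fset S}, A = [fset f b | b in B]%fset.
Proof.
move=> Af.
have h (p : A) : exists b, f b = val p.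
  by have [b _ <-] := Af _ (valP p); exists b.
have [g fg] := choice h.
exists [fset g p | p in {: A}]%fset; apply/fsetP => x.
apply/idP/imfsetP => [xA|].
  exists (g [` xA]%fset); last by rewrite fg.
  by apply/imfsetP; exists [` xA]%fset.
by move=> [b /imfsetP[p _ ->] ->]; rewrite fg; exact: valP.
Qed.

Section Slice.
Context {K : fieldType} {k : nat} {n : 'I_k -> nat}.
Variables (i0 : 'I_k) (J : multiindex n).

(** The contraction of [T] with the coordinate functionals given by [J] on all factors other than
    [i0]. *)
Definition slice (T : tensor_space K n) : 'rV[K]_(n i0).+1 :=
  \row_j T [ffun i => dfwith J j i].

Lemma slice_is_linear : linear slice.
Proof. by move=> c S T; apply/rowP => j; rewrite !mxE !ffunE. Qed.

HB.instance Definition _ :=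
  GRing.isLinear.Build K (tensor_space K n) 'rV[K]_(n i0).+1 _ slice
    slice_is_linear.

Lemma slice_tensor (v : forall i, 'rV[K]_(n i).+1) :
  slice (tensor v) = (\prod_(i < k | i != i0) v i 0 (J i)) *: v i0.
Proof.
apply/rowP => j; rewrite !mxE ffunE (bigD1 i0)//= ffunE dfwith_in mulrC.
congr (_ * _); apply: eq_bigr => i ii0.
by rewrite ffunE dfwith_out// eq_sym.
Qed.

Definition slice_preim (L : {vspace 'rV[K]_(n i0).+1}) :
    {vspace tensor_space K n} :=
  (linfun slice @^-1: L)%VS.

Lemma mem_slice_preim T (L : {vspace 'rV[K]_(n i0).+1}) :
  (T \in slice_preim L) = (slice T \in L).
Proof. by rewrite /slice_preim -memv_preim lfunE. Qed.

End Slice.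

Lemma tensor_dfwithD (K : fieldType) (k : nat) (n : 'I_k -> nat)
    (v : forall i, 'rV[K]_(n i).+1) (i0 : 'I_k) (x y : 'rV[K]_(n i0).+1) :
  tensor (dfwith v (x + y)) = tensor (dfwith v x) + tensor (dfwith v y).
Proof.
apply/ffunP => J; rewrite !ffunE.
have prodE z : \prod_i dfwith v z i 0 (J i) =
    z 0 (J i0) * \prod_(i | i != i0) v i 0 (J i).
  rewrite (bigD1 i0)//= dfwith_in; congr (_ * _); apply: eq_bigr => i ii0.
  by rewrite dfwith_out// eq_sym.
by rewrite !prodE mxE mulrDl.
Qed.

Theorem theorem1p3 (K : closedFieldType) (k : nat) (n : 'I_k -> nat)
    (hk : (0 < k)%N) (hn : forall i, (0 < n i)%N)
    (L : forall i : 'I_k, {vspace 'rV[K]_(n i).+1})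
    (hL : forall i, L i != 0%VS)
    (hYdim : (0 < multisub_dim L)%N)
    (hYW : multisub L `<` [set: multiproj K n])
    (q : proj (tensor_space K n))
    (hq : pspan (@segre K k n @` multisub L) q) :
  exists B : {fset multiproj K n},
    ~ ([set` B] `<=` multisub L) /\
    solutions (range (@segre K k n)) q
      (Xrank (@segre K k n @` multisub L) q).+1
      [fset segre b | b in B]%fset.
Proof.
(* If every [L i] were the full space, [Y] would be all of [W]. *)
have [i0 [u uL]] : exists i0, exists u, u \notin L i0.
  case: hYW => _ nWY; apply: contrapT => h; apply: nWY => x _ i.
  apply/subvP => u _; apply: contrapT => uL; apply: h.
  by exists i; exists u; exact/negP.
have [A1 [A1Y A1q]] := pspan_finite hq.
have [[A [AY <- Aq]] Amin] := XrankP A1Y A1q.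
have Airr : irredundantly_spans A q.
  split=> // A' A'A A'q; have := fproper_ltn_card A'A.
  rewrite ltnNge => /negP; apply.
  rewrite Amin//; exists A'; split=> // p pA'; apply: AY.
  exact: (fsubsetP (fproper_sub A'A)).
(* The empty set spans the zero space, which cannot contain the line [q]. *)
have [p pA] : exists p, p \in A.
  have [A0|//] := fset_0Vmem A; last by move=> [p pA]; exists p.
  move: Aq => /pspan_fset; rewrite A0 /fset_span big_nil => /dimvS.
  by rewrite dimv0 (eqP (dim_line q)).
have [a aY ap] := AY _ pA.
pose w i := vpick (a i).
have w0 i : w i != 0 by exact: vpick_proj_neq0.
have wL : w i0 \in L i0 by apply: (subvP (aY i0)); exact: memv_pick.
(* With these indices the scalar in [slice_tensor] is nonzero for every tensor that differs from
   [tensor w] in the factor [i0] alone. *)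
have hJ i : {j | w i 0 j != 0}.
  by apply: sigW; have /rV0Pn[j wj] := w0 i; exists j.
pose J : multiindex n := [ffun i => sval (hJ i)].
pose U := slice_preim J (L i0).
have YU x : multisub L x -> (segre x <= U)%VS.
  move=> xY; rewrite -memvE mem_slice_preim slice_tensor memvZ//.
  by apply: (subvP (xY i0)); exact: memv_pick.
have AU x : x \in A -> (x <= U)%VS by move=> /AY[y yY <-]; exact: YU.
have neq0 x : x \notin L i0 -> forall i, dfwith w x i != 0.
  move=> xL i; case: dfwithP => //.
  by apply: contraNneq xL => ->; rewrite mem0v.
(* The slice of this tensor is a nonzero multiple of [x], hence outside [L i0]. *)
have nU x (xL : x \notin L i0) : ~~ (Defs.point (tensor_neq0 (neq0 x xL)) <= U)%VS.
  rewrite -memvE mem_slice_preim slice_tensor dfwith_in.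
  rewrite rpredZeq negb_or xL andbT; apply/prodf_neq0 => i; rewrite eq_sym => ii0.
  by rewrite dfwith_out// ffunE; exact: (svalP (hJ i)).
have uL' : w i0 - u \notin L i0.
  by apply: contra uL => /(memvB wL); rewrite opprB addrC subrK.
pose b := Defs.point (tensor_neq0 (neq0 u uL)).
pose b' := Defs.point (tensor_neq0 (neq0 _ uL')).
have pbb' : (p <= b + b')%VS.
  (* Multilinearity in the factor [i0] then writes [tensor w] as a sum of representatives of [b] and
     [b']. *)
  have wE : w = dfwith w (u + (w i0 - u)).
    rewrite addrC subrK; apply: functional_extensionality_dep => i.
    by case: dfwithP.
  rewrite -ap -memvE /= -/w {1}wE tensor_dfwithD.
  by apply: memv_add; exact: memv_line.
have [Birr cardB] :=
  irredundantly_spans_split Airr AU pA (nU _ uL) (nU _ uL') pbb'.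
have BW : [set` (b |` (b' |` A `\ p))%fset] `<=` range (@segre K k n).
  move=> x /fset1UP[->|/fset1UP[->|/fsetD1P[_ /AY[y _ <-]]]]; last by exists y.
    by exists [ffun i => Defs.point (neq0 _ uL i)] => //; exact: segreE.
  by exists [ffun i => Defs.point (neq0 _ uL' i)] => //; exact: segreE.
have [B BE] := fset_preimage BW.
exists B; rewrite -BE; split=> // BY.
(* A preimage of [b] in [Y] would force [b] into [U]. *)
have : b \in [fset segre x | x in B]%fset by rewrite -BE fset1U1.
move=> /imfsetP[x xB bx]; case/negP: (nU _ uL).
by rewrite -/b bx; apply/YU/BY.
Qed.
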